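(* Let $G$ be the graph with vertex set $\{a_i,b_i,c_i : i\in[4]\}\cup\{q_i^j,r_i^j : i\in[4], j\in[2]\}$ (28 vertices) and the following edges, where indices of $a,b,c$ are taken so that $i\bmod 4+1$ follows $i$: the three four-cycles $a_ia_{i\bmod 4+1}$, $b_ib_{i\bmod 4+1}$, $c_ic_{i\bmod 4+1}$ for $i\in[4]$; the edges $q_i^j a_k, q_i^j b_k, q_i^j c_k$ for all $i,k\in[4]$, $j\in[2]$; the edges $r_i^jq_i^j$ for $i\in[4],j\in[2]$; and the edges $r_i^ja_i, r_i^ja_{i\bmod 4+1}, r_i^jb_i, r_i^jb_{i\bmod 4+1}, r_i^jc_i, r_i^jc_{i\bmod 4+1}$ for $i\in[4],j\in[2]$. Then $G$ does not admit a planar geometric storyplan.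
   Context: A storyplan of a graph $G$ on time steps $[\ell]=\{1,\dots,\ell\}$ is a pair $(A,\mathcal{D})$ where: $A$ assigns to each vertex $v$ a nonempty interval $A(v)=[s_v,e_v]\subseteq[\ell]$ of consecutive integers (the visible interval; $v$ is visible at each $t\in A(v)$); for every edge $uv$ we have $A(u)\cap A(v)\neq\emptyset$; and $\mathcal{D}$ assigns one fixed point to each vertex and one fixed curve to each edge. For $t\in[\ell]$, the frame at $t$ is the drawing under $\mathcal{D}$ of the induced subgraph $G[\{v : t\in A(v)\}]$. A storyplan is planar geometric if every frame is a planar drawing in which every edge is a straight-line segment. *)

(* Defs.v *)
From Stdlib Require Import Reals.
From mathcomp Require Import all_boot.

Set Implicit Arguments.
Unset Strict Implicit.
Unset Printing Implicit Defensive.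

Definition point := (R * R)%type.

Definition on_segment (p q z : point) : Prop :=
  exists lam : R, Rle 0 lam /\ Rle lam 1 /\
    z = (Rplus (Rmult (Rminus 1 lam) (fst p)) (Rmult lam (fst q)),
         Rplus (Rmult (Rminus 1 lam) (snd p)) (Rmult lam (snd q))).

Definition planar_straight_frame (V : Type) (adj : V -> V -> Prop)
    (pos : V -> point) (S : V -> Prop) : Prop :=
  (forall u v, S u -> S v -> u <> v -> pos u <> pos v) /\
  (forall u v w, S u -> S v -> S w -> adj u v -> w <> u -> w <> v ->
      ~ on_segment (pos u) (pos v) (pos w)) /\
  (forall u v x y z, S u -> S v -> S x -> S y -> adj u v -> adj x y ->
      ~ ((u = x /\ v = y) \/ (u = y /\ v = x)) ->
      on_segment (pos u) (pos v) z -> on_segment (pos x) (pos y) z ->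
      exists w, (w = u \/ w = v) /\ (w = x \/ w = y) /\ z = pos w).

Definition has_planar_geometric_storyplan (V : Type) (adj : V -> V -> Prop)
    : Prop :=
  exists (l : nat) (s e : V -> nat) (pos : V -> point),
    (forall v, (1 <= s v)%coq_nat /\ (s v <= e v)%coq_nat /\ (e v <= l)%coq_nat) /\
    (forall u v, adj u v -> exists t,
        (s u <= t <= e u)%coq_nat /\ (s v <= t <= e v)%coq_nat) /\
    (forall t, (1 <= t <= l)%coq_nat ->
        planar_straight_frame adj pos (fun v => (s v <= t <= e v)%coq_nat)).

(* Indices i in [4] are represented by 'I_4 (i.e. i-1), j in [2] by 'I_2. *)
Inductive vtx : Type :=
  | va of 'I_4 | vb of 'I_4 | vc of 'I_4
  | vq of 'I_4 & 'I_2 | vr of 'I_4 & 'I_2.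

(* cyclic successor: corresponds to i |-> i mod 4 + 1 on [4] *)
Definition nxt (i : 'I_4) : 'I_4 := ordS i.

Definition edge0 (u v : vtx) : Prop :=
  match u, v with
  | va i, va k => k = nxt i
  | vb i, vb k => k = nxt i
  | vc i, vc k => k = nxt i
  | vq _ _, va _ => True
  | vq _ _, vb _ => True
  | vq _ _, vc _ => True
  | vr i j, vq i' j' => i' = i /\ j' = j
  | vr i _, va k => k = i \/ k = nxt i
  | vr i _, vb k => k = i \/ k = nxt i
  | vr i _, vc k => k = i \/ k = nxt i
  | _, _ => False
  end.

Definition G_adj (u v : vtx) : Prop := edge0 u v \/ edge0 v u.

(* Main.v *)
Require Import Defs.
From HB Require Import structures.
From Stdlib Require Import Reals Lra Psatz Classical.
From mathcomp Require Import all_boot zify.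

Set Implicit Arguments.
Unset Strict Implicit.
Unset Printing Implicit Defensive.

(* Write [X] for the twelve cycle vertices and [Q] for the hubs q_i^j.

   After a small perturbation of the vertex positions no three of them are collinear,
   and edges without a common end that are disjoint in a frame still do not cross. What
   remains of the drawing is the orientation of the triples of vertices, and the
   impossibility of the relevant planar drawings on at most six points becomes a
   propositional problem, refuted by a verified DPLL procedure from the Grassmann-Pluecker
   sign conditions.

   If all hubs met pairwise, then, since C_4 is not an interval graph, they would meet
   three consecutive vertices of a cycle at one time, which yields a K_{3,3}. So some two
   hubs do not meet; every vertex of [X] spans the gap between them, hence [X] meets
   pairwise. But then no two hubs meet, because two hubs, a cycle and a vertex of another
   cycle contain a subdivided K_5. All hubs but the first and the last one are therefore
   visible only while all of [X] is visible, and some q_i^j and q_(i+2)^j' are both of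
   this kind. In a frame containing q_i^j, r_i^j and [X], any two cycles include one that
   lies behind its edge with index i: the other three edges turn the opposite way around
   the hub. No quadrilateral is seen like this from one point for its edge i and from
   another one for the opposite edge i+2; but two of the three cycles are for i, and two
   of the three for i+2. *)

(** * Satisfiability *)

Section Dpll.
Variable X : eqType.
Definition literal := (X * bool)%type.
Definition cnf := seq (seq literal).

Definition sat (g : X -> bool) (F : cnf) : bool :=
  all (has (fun l : literal => g l.1 == l.2)) F.

Definition assign (x : X) (b : bool) (F : cnf) : cnf :=
  [seq [seq l <- c | l.1 != x] | c <- F & (x, b) \notin c].

Fixpoint shortest (c : seq literal) (F : cnf) : seq literal :=
  if F is c' :: F' then shortest (if size c' < size c then c' else c) F' else c.

(** Branching on a literal of a shortest clause includes unit propagation: for a unit clause the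
    first branch yields the empty clause at once. Running out of fuel counts as failure. *)
Fixpoint refute (k : nat) (F : cnf) : bool :=
  if has (@nilp _) F then true else
  if k is k'.+1 then
    if shortest (head [::] F) F is (x, b) :: _ then
      if refute k' (assign x (~~ b) F) then refute k' (assign x b F) else false
    else false
  else false.

(** A clause that survives lacks the literal [(x, g x)], so its true literal is on another variable
    and is kept. *)
Lemma sat_assign g x F : sat g F -> sat g (assign x (g x) F).
Proof.
move=> /allP satF; apply/allP=> c' /mapP[c]; rewrite mem_filter => /andP[nxc cF] ->.
have /hasP[[y b] yc /= /eqP gy] := satF _ cF.
apply/hasP; exists (y, b) => /=; last by rewrite gy.
rewrite mem_filter yc andbT /=; apply: contraNneq nxc => <-; by rewrite gy.
Qed.

Lemma refute_sound k g F : refute k F -> ~~ sat g F.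
Proof.
elim: k F => [|k IHk] F /=; case: ifP => [/hasP[c cF /nilP c0] _|_] //.
- by apply/allPn; exists c => //; rewrite c0.
- by apply/allPn; exists c => //; rewrite c0.
case: (shortest _ _) => [|[x b] _] //; case: ifP => // ref1 ref2.
apply/negP => /(sat_assign x).
by case: (g x) b ref1 ref2 => [] [] /IHk/negP ? /IHk/negP.
Qed.
End Dpll.

(** * Orientations of triples and their propositional encoding *)

Definition crossing (V : Type) (o : V -> V -> V -> bool) (a b c d : V) : bool :=
  (o a b c != o a b d) && (o c d a != o c d b).

(* Sign conditions forced by [abc] - [abd] + [acd] - [bcd] = 0 and by the
   Grassmann-Pluecker relation [abc][ade] - [abd][ace] + [abe][acd] = 0. *)
Record orientation (V : eqType) (o : V -> V -> V -> bool) : Prop := Orientation {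
  orient_rot : forall a b c, o b c a = o a b c;
  orient_swap : forall a b c, uniq [:: a; b; c] -> o b a c = ~~ o a b c;
  orient_quad : forall a b c d, uniq [:: a; b; c; d] ->
    ~~ constant [:: o a b c; ~~ o a b d; o a c d; ~~ o b c d];
  orient_plucker : forall a b c d e, uniq [:: a; b; c; d; e] ->
    ~~ constant [:: o a b c == o a d e; o a b d != o a c e; o a b e == o a c d] }.

Section Refutation.
Definition triple := (nat * nat * nat)%type.

(* Variables are increasing triples of indices; [lit b i j k] says that the orientation
   of the points i, j, k is [b]. *)
Definition lit (b : bool) (i j k : nat) : triple * bool :=
  if i < j then
    if j < k then ((i, j, k), b)
    else if i < k then ((i, k, j), ~~ b) else ((k, i, j), b)
  else if i < k then ((j, i, k), ~~ b)
  else if j < k then ((j, k, i), b) else ((k, j, i), ~~ b).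

Definition bools := [:: true; false].
Definition pairs (A : Type) (s : seq A) := [seq (x, y) | x <- s, y <- s].

Definition quad_cnf (i j k l : nat) : cnf triple :=
  [seq [:: lit b i j k; lit (~~ b) i j l; lit b i k l; lit (~~ b) j k l] | b <- bools].

(** Each clause excludes one assignment giving the three signed products the same sign: [b] fixes
    that sign, and [x], [y], [z] fix the first factor of each product. *)
Definition plucker_cnf (i j k l m : nat) : cnf triple :=
  [seq let: ((x, y), (z, b)) := v in
       [:: lit x i j k; lit (b (+) x) i l m; lit y i j l; lit (~~ b (+) y) i k m;
           lit z i j m; lit (b (+) z) i k l] | v <- pairs (pairs bools)].

Definition crossing_cnf (i j k l : nat) : cnf triple :=
  [seq [:: lit v.1 i j k; lit (~~ v.1) i j l; lit v.2 k l i; lit (~~ v.2) k l j]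
  | v <- pairs bools].

(** Each list in [Es] holds edges seen in one frame; edges from different lists may cross. By
    antisymmetry increasing indices suffice for the sign conditions. *)
Definition drawing_cnf (n : nat) (Es : seq (seq (nat * nat))) : cnf triple :=
  let I4 := pairs (pairs (iota 0 n)) in
  flatten
    ([seq let: ((i, j), (k, l)) := v in
          if [&& i < j, j < k & k < l] then quad_cnf i j k l else [::] | v <- I4] ++
     [seq let: ((i, j), (k, l)) := v in
          if [&& i < j, j < k, k < l & m \notin [:: i; j; k; l]]
          then plucker_cnf m i j k l else [::] | v <- I4, m <- iota 0 n] ++
     [seq let: ((i, j), (k, l)) := v in
          if uniq [:: i; j; k; l] then crossing_cnf i j k l else [::]
     | v <- flatten (map (@pairs _) Es)]).

Definition term := (bool * triple)%type.
Definition flip (l : triple * bool) := (l.1, ~~ l.2).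

Definition term_lit (t : term) := lit t.1 t.2.1.1 t.2.1.2 t.2.2.

(* [(true, L)] asks the terms of [L] to have the same value, [(false, L)] the contrary. *)
Definition constancy_cnf (c : bool * seq term) : cnf triple :=
  let L := map term_lit c.2 in
  if c.1 then [seq [:: flip l; l'] | l <- L, l' <- L] else [:: L; map flip L].

Definition valid (n : nat) (s : seq nat) := uniq s && all (fun i => i < n) s.
Definition valid_term (n : nat) (t : term) := valid n [:: t.2.1.1; t.2.1.2; t.2.2].

(** Every branching eliminates a triple, so fuel 100 is ample for the 20 triples of six points. *)
Definition refuted (n : nat) (Es : seq (seq (nat * nat))) (X : seq (bool * seq term)) : bool :=
  [&& all (all (fun e => (e.1 < n) && (e.2 < n))) Es, all (fun c => all (valid_term n) c.2) X
    & refute 100 (drawing_cnf n Es ++ flatten (map constancy_cnf X))].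

Variables (V : eqType) (o : V -> V -> V -> bool) (v0 : V) (vs : seq V).
Hypotheses (o_or : orientation o) (uniq_vs : uniq vs).
Let p := nth v0 vs.
Let g (t : triple) := o (p t.1.1) (p t.1.2) (p t.2).

(** Later also used to select sublists of a list of distinct points: with concrete indices the
    premise holds by computation. *)
Lemma valid_uniq s : valid (size vs) s -> uniq (map p s).
Proof.
case/andP=> us /allP s_lt; rewrite map_inj_in_uniq // => i j /s_lt i_lt /s_lt j_lt /eqP.
by rewrite nth_uniq // => /eqP.
Qed.

Lemma valid_all (S : pred V) s : all S vs -> valid (size vs) s -> all S (map p s).
Proof.
move=> /allP S_vs /andP[_ /allP s_lt]; rewrite all_map; apply/allP=> i /s_lt i_lt.
by apply: S_vs; rewrite mem_nth.
Qed.

Lemma lit_holds b i j k : valid (size vs) [:: i; j; k] ->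
  (g (lit b i j k).1 == (lit b i j k).2) = (o (p i) (p j) (p k) == b).
Proof.
move=> v_ijk; have u_ijk := valid_uniq v_ijk.
have o_jik : o (p j) (p i) (p k) = ~~ o (p i) (p j) (p k) by exact: orient_swap.
have o_kij : o (p k) (p i) (p j) = o (p i) (p j) (p k) by rewrite -orient_rot.
have o_jki : o (p j) (p k) (p i) = o (p i) (p j) (p k) by exact: orient_rot.
have o_ikj : o (p i) (p k) (p j) = ~~ o (p i) (p j) (p k)
  by rewrite -orient_rot // orient_rot // -o_jik orient_rot.
have o_kji : o (p k) (p j) (p i) = ~~ o (p i) (p j) (p k) by rewrite orient_rot.
have neg (x y : bool) : (~~ x == ~~ y) = (x == y) by case: x y => [] [].
by rewrite /lit; do 3?[case: ifP => _]; rewrite /g /= ?(o_jik, o_kij, o_jki, o_ikj, o_kji) ?neg.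
Qed.

Definition term_val (t : term) : bool :=
  let v := o (p t.2.1.1) (p t.2.1.2) (p t.2.2) in if t.1 then v else ~~ v.

Lemma valid_map (s t : seq nat) :
  valid (size vs) s -> uniq t && all (fun i => i < size s) t -> valid (size vs) (map (nth 0 s) t).
Proof.
case/andP=> us /allP s_lt /andP[ut /allP t_lt]; apply/andP; split.
  rewrite map_inj_in_uniq // => i j /t_lt i_lt /t_lt j_lt /eqP.
  by rewrite nth_uniq // => /eqP.
by apply/allP=> _ /mapP[i /t_lt i_lt ->]; apply: s_lt; rewrite mem_nth.
Qed.

Lemma sat_quad i j k l : valid (size vs) [:: i; j; k; l] -> sat g (quad_cnf i j k l).
Proof.
move=> v4; have := orient_quad o_or (valid_uniq v4); have sub t := @valid_map _ t v4.
rewrite /sat /= !lit_holds;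
  try by [exact: (sub [:: 0; 1; 2]) | exact: (sub [:: 0; 1; 3])
         | exact: (sub [:: 0; 2; 3]) | exact: (sub [:: 1; 2; 3])].
by case: (o _ _ _) (o _ _ _) (o _ _ _) (o _ _ _) => [] [] [] [].
Qed.

Lemma sat_plucker m i j k l : valid (size vs) [:: m; i; j; k; l] -> sat g (plucker_cnf m i j k l).
Proof.
move=> v5; have := orient_plucker o_or (valid_uniq v5); have sub t := @valid_map _ t v5.
rewrite /sat /= !lit_holds;
  try by [exact: (sub [:: 0; 1; 2]) | exact: (sub [:: 0; 1; 3]) | exact: (sub [:: 0; 1; 4])
         | exact: (sub [:: 0; 2; 3]) | exact: (sub [:: 0; 2; 4]) | exact: (sub [:: 0; 3; 4])].
by case: (o _ _ _) (o _ _ _) (o _ _ _) (o _ _ _) (o _ _ _) (o _ _ _) => [] [] [] [] [] [].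
Qed.

Lemma sat_crossing i j k l : valid (size vs) [:: i; j; k; l] ->
  ~~ crossing o (p i) (p j) (p k) (p l) -> sat g (crossing_cnf i j k l).
Proof.
move=> v4; have sub t := @valid_map _ t v4.
rewrite /crossing /sat /= !lit_holds;
  try by [exact: (sub [:: 0; 1; 2]) | exact: (sub [:: 0; 1; 3])
         | exact: (sub [:: 2; 3; 0]) | exact: (sub [:: 2; 3; 1])].
by case: (o _ _ _) (o _ _ _) (o _ _ _) (o _ _ _) => [] [] [] [].
Qed.

Lemma sat_constancy c : all (valid_term (size vs)) c.2 ->
  constant (map term_val c.2) = c.1 -> sat g (constancy_cnf c).
Proof.
case: c => b ts /= /allP v_ts; rewrite /constancy_cnf /=.
pose w (l : triple * bool) := g l.1 == l.2.
have -> : map term_val ts = map w (map term_lit ts).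
  rewrite -map_comp; apply/eq_in_map => t /v_ts v_t /=.
  by rewrite /w lit_holds // /term_val; case: t.1; case: (o _ _ _).
move: (map term_lit ts) => L.
have w_flip l : w (flip l) = ~~ w l by rewrite /w /=; case: (g _) l.2 => [] [].
have all_w c : all (pred1 c) (map w L) -> constant (map w L).
  by case: (map w L) => //= x s /andP[/eqP->].
case: b => cst; rewrite /sat.
  apply/allP=> _ /allpairsP[[l l'] [/= lL l'L ->]] /=.
  have w_eq x : x \in L -> w x = head true (map w L).
    move=> /(map_f w); case: (map w L) cst => //= y s /allP y_s; rewrite inE.
    by case/predU1P=> [|/y_s/eqP].
  by rewrite orbF -[_ || _]/(w (flip l) || w l') w_flip !w_eq // orNb.
rewrite /= andbT; apply/andP; split; apply: contraFT cst => /hasPn all_f.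
  by apply: (all_w false); apply/allP=> _ /mapP[l /all_f nl ->] /=; rewrite eqbF_neg.
apply: (all_w true); apply/allP=> _ /mapP[l lL ->] /=.
by rewrite eqb_id -[w l]negbK -w_flip; apply: all_f (map_f _ lL).
Qed.

(** Read as an assignment, the orientations of an actual drawing satisfy all clauses of
    [drawing_cnf]; if the constraints [X] held as well, the refuted formula would be satisfied. *)
Lemma refutation (Es : seq (seq (nat * nat))) X :
  (forall E e f, E \in Es -> e \in E -> f \in E -> uniq [:: p e.1; p e.2; p f.1; p f.2] ->
     ~~ crossing o (p e.1) (p e.2) (p f.1) (p f.2)) ->
  refuted (size vs) Es X -> ~~ all (fun c => constant (map term_val c.2) == c.1) X.
Proof.
move=> drawn /and3P[/allP E_lt /allP vX /(refute_sound g) unsat].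
apply: contra unsat => /allP holds; rewrite /sat all_cat.
have all_flat (FF : seq (cnf triple)) : {in FF, forall F, sat g F} ->
    all (has (fun l : literal triple => g l.1 == l.2)) (flatten FF).
  by move=> sFF; apply/allP=> c /flattenP[F /sFF/allP]; apply.
have in_iota4 v : v \in pairs (pairs (iota 0 (size vs))) ->
    all (fun i => i < size vs) [:: v.1.1; v.1.2; v.2.1; v.2.2].
  case/allpairsP=> -[_ _] [/allpairsP[[i j] [/= iI jI ->]]] /allpairsP[[k l] [/= kI lI ->]] ->.
  by move: iI jI kI lI; rewrite !mem_iota /= => -> -> -> ->.
have lt_uniq i j k l : [&& i < j, j < k & k < l] -> uniq [:: i; j; k; l].
  by case/and3P=> ij jk kl; apply: (sorted_uniq ltn_trans ltnn); rewrite /= ij jk kl.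
apply/andP; split; last first.
  by apply: all_flat => _ /mapP[c cX ->]; apply: sat_constancy (vX _ cX) (eqP (holds _ cX)).
apply: all_flat => F; rewrite !mem_cat => /or3P[].
- move=> /mapP[[[i j] [k l]] /in_iota4 v_lt ->]; case: ifP => // /lt_uniq u4.
  by apply: sat_quad; rewrite /valid u4.
- move=> /allpairsP[[[[i j] [k l]] m] [/= /in_iota4 v_lt m_lt ->]].
  case: ifP => // /and4P[ij jk kl m_ijkl]; apply: sat_plucker.
  have u4 : uniq [:: i; j; k; l] by rewrite lt_uniq // ij jk.
  move: m_lt; rewrite mem_iota /= => m_lt.
  by rewrite /valid cons_uniq m_ijkl u4 /= m_lt.
case/mapP=> _ /flattenP[_ /mapP[E EEs ->]] /allpairsP[[[i j] [k l]] [/= ijE klE ->]] ->.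
case: ifP => // u4; have /allP lt := E_lt _ EEs.
have /andP[i_lt j_lt] := lt _ ijE; have /andP[k_lt l_lt] := lt _ klE.
have v4 : valid (size vs) [:: i; j; k; l] by apply/andP; split; rewrite //= i_lt j_lt k_lt l_lt.
exact: sat_crossing (drawn _ _ _ EEs ijE klE (valid_uniq v4)).
Qed.

End Refutation.

(** * Straight-line drawings of wheels and octahedra *)

Section Configurations.
Variables (V : eqType) (o : V -> V -> V -> bool) (adj : rel V) (S : nat -> pred V).
Hypotheses (o_or : orientation o).
Hypothesis planar : forall t a b c d, all (S t) [:: a; b; c; d] -> uniq [:: a; b; c; d] ->
  adj a b -> adj c d -> ~~ crossing o a b c d.

(** Each edge list may have its own frame, because orientations do not depend on time. *)
Lemma frames_refutation v0 (vs : seq V) (Es : seq (seq (nat * nat))) X :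
  let p := nth v0 vs in
  uniq vs ->
  (forall E, E \in Es -> exists t, all
     (fun e => [&& adj (p e.1) (p e.2), S t (p e.1) & S t (p e.2)]) E) ->
  refuted (size vs) Es X ->
  ~~ all (fun c => constant (map (term_val o v0 vs) c.2) == c.1) X.
Proof.
move=> p u_vs shown; apply: (refutation o_or u_vs) => E e f /shown[t /allP shE].
move=> /shE/and3P[ae S1 S2] /shE/and3P[af S3 S4] u4.
by apply: (planar (t := t)) => //=; rewrite S1 S2 S3 S4.
Qed.

Lemma planar_refutation t v0 (vs : seq V) E X :
  uniq vs -> all (S t) vs -> all (fun e => adj (nth v0 vs e.1) (nth v0 vs e.2)) E ->
  refuted (size vs) [:: E] X ->
  ~~ all (fun c => constant (map (term_val o v0 vs) c.2) == c.1) X.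
Proof.
move=> u_vs /allP S_vs /allP adjE ref; apply: (frames_refutation u_vs) (ref) => E'.
rewrite inE => /eqP-> {E'}; exists t; have /and3P[/andP[/allP E_lt _] _ _] := ref.
by apply/allP=> e eE; have /andP[? ?] := E_lt _ eE; rewrite adjE // !S_vs ?mem_nth.
Qed.

(* In a planar drawing of a wheel, [inner] means that the hub [q] is inside the
   quadrilateral abcd, [flipped] that c and d are in the triangle qab. *)
Definition inner (q a b c d : V) := constant [:: o q a b; o q b c; o q c d; o q d a].
Definition flipped (q a b c d : V) := constant [:: ~~ o q a b; o q b c; o q c d; o q d a].
Definition inside (p a b c : V) := constant [:: o p a b; o p b c; o p c a].

Definition joined (E : seq (V * V)) := all (fun e => adj e.1 e.2) E.
Definition wheel_edges (T : Type) (q a b c d : T) : seq (T * T) :=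
  [:: (a, b); (b, c); (c, d); (d, a); (q, a); (q, b); (q, c); (q, d)].

Lemma no_K33 k a b c x y z :
  uniq [:: a; b; c; x; y; z] -> all (S k) [:: a; b; c; x; y; z] ->
  ~~ joined [seq (u, v) | u <- [:: a; b; c], v <- [:: x; y; z]].
Proof.
move=> u6 S6; apply/negP=> adjE.
have ref : refuted 6 [:: [seq (i, j) | i <- [:: 0; 1; 2], j <- [:: 3; 4; 5]]] [::] by vm_compute.
by have /(_ adjE) := planar_refutation (v0 := a) u6 S6 _ ref.
Qed.

Definition inner_terms (q a b c d : nat) : seq term :=
  [:: (true, (q, a, b)); (true, (q, b, c)); (true, (q, c, d)); (true, (q, d, a))].
Definition flipped_terms (q a b c d : nat) : seq term :=
  [:: (false, (q, a, b)); (true, (q, b, c)); (true, (q, c, d)); (true, (q, d, a))].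
Definition inside_terms (p a b c : nat) : seq term :=
  [:: (true, (p, a, b)); (true, (p, b, c)); (true, (p, c, a))].

(** The two wheels form an octahedron, in whose planar embedding the quadrilateral separates the
    hubs; the one inside sees all four sides turn the same way. *)
Lemma inner_wheel k q q' a b c d :
  uniq [:: q; q'; a; b; c; d] -> all (S k) [:: q; q'; a; b; c; d] ->
  joined (wheel_edges q a b c d) -> joined (wheel_edges q' a b c d) ->
  inner q a b c d || inner q' a b c d.
Proof.
move=> u6 S6 w w'; apply: contraT; rewrite negb_or => /andP[n n'].
have ref : refuted 6 [:: wheel_edges 0 2 3 4 5 ++ wheel_edges 1 2 3 4 5]
  [:: (false, inner_terms 0 2 3 4 5); (false, inner_terms 1 2 3 4 5)] by vm_compute.
have {ref} := planar_refutation (v0 := a) u6 S6 _ ref.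
rewrite all_cat => /(_ (introT andP (conj w w'))) /negP[].
by apply/and3P; split=> //; apply/eqP/negbTE.
Qed.

(** As [q] is inner, c lies outside the triangle qab; from inside it the edge from [q'] to c would
    have to cross a side. *)
Lemma outer_hub k q q' a b c d :
  uniq [:: q; q'; a; b; c; d] -> all (S k) [:: q; q'; a; b; c; d] ->
  joined (wheel_edges q a b c d) -> joined (wheel_edges q' a b c d) ->
  inner q a b c d -> ~~ inside q' q a b.
Proof.
move=> u6 S6 w w' inn; apply/negP=> ins.
have ref : refuted 6 [:: wheel_edges 0 2 3 4 5 ++ wheel_edges 1 2 3 4 5]
  [:: (true, inner_terms 0 2 3 4 5); (true, inside_terms 1 0 2 3)] by vm_compute.
have {ref} := planar_refutation (v0 := a) u6 S6 _ ref.
rewrite all_cat => /(_ (introT andP (conj w w'))) /negP[].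
by apply/and3P; split=> //; apply/eqP.
Qed.

(** The four angles at [q] cover the plane, and the edge from [e] to [q] cannot cross the side of
    the quadrilateral that closes its angle. *)
Lemma inner_wheel_spoke k q e a b c d :
  uniq [:: q; e; a; b; c; d] -> all (S k) [:: q; e; a; b; c; d] ->
  joined (wheel_edges q a b c d) -> adj e q -> inner q a b c d ->
  [|| inside e q a b, inside e q b c, inside e q c d | inside e q d a].
Proof.
move=> u6 S6 w eq inn; apply: contraT; rewrite !negb_or => /and4P[n1 n2 n3 n4].
have ref : refuted 6 [:: (1, 0) :: wheel_edges 0 2 3 4 5]
  [:: (true, inner_terms 0 2 3 4 5); (false, inside_terms 1 0 2 3);
      (false, inside_terms 1 0 3 4); (false, inside_terms 1 0 4 5);
      (false, inside_terms 1 0 5 2)] by vm_compute.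
have {ref} := planar_refutation (v0 := a) u6 S6 _ ref.
move=> /(_ (introT andP (conj eq w)))/negP[].
by apply/and5P; split; last (apply/andP; split=> //); apply/eqP=> //; apply/negbTE.
Qed.

(** The edge from [e] to [q'] cannot cross a side of the triangle. *)
Lemma triangle_no_exit k q a b e q' :
  uniq [:: q; a; b; e; q'] -> all (S k) [:: q; a; b; e; q'] ->
  joined [:: (q, a); (q, b); (a, b); (e, q); (e, q'); (q', a); (q', b)] ->
  inside e q a b -> inside q' q a b.
Proof.
move=> u5 S5 adjE ins; apply: contraT => out.
have ref : refuted 5 [:: [:: (0, 1); (0, 2); (1, 2); (3, 0); (3, 4); (4, 1); (4, 2)]]
  [:: (true, inside_terms 3 0 1 2); (false, inside_terms 4 0 1 2)] by vm_compute.
have {ref} /(_ adjE)/negP[] := planar_refutation (v0 := a) u5 S5 _ ref.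
by apply/and3P; split=> //; apply/eqP=> //; apply/negbTE.
Qed.

(** A wheel has only one face with q, a and b on its boundary, the one bounded by qab, so [r] lies
    in it. If this is the outer face, c and d are in the triangle. *)
Lemma wheel_triangle k q r a b c d :
  uniq [:: q; r; a; b; c; d] -> all (S k) [:: q; r; a; b; c; d] ->
  joined (wheel_edges q a b c d) -> joined [:: (r, q); (r, a); (r, b)] ->
  flipped q a b c d || inside r q a b.
Proof.
move=> u6 S6 w adjr; apply: contraT; rewrite negb_or => /andP[n n'].
have ref : refuted 6 [:: wheel_edges 0 2 3 4 5 ++ [:: (1, 0); (1, 2); (1, 3)]]
  [:: (false, flipped_terms 0 2 3 4 5); (false, inside_terms 1 0 2 3)] by vm_compute.
have {ref} := planar_refutation (v0 := a) u6 S6 _ ref.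
rewrite all_cat => /(_ (introT andP (conj w adjr))) /negP[].
by apply/and3P; split=> //; apply/eqP/negbTE.
Qed.

Lemma triangles_sharing_hub k q r a b x y :
  uniq [:: q; r; a; b; x; y] -> all (S k) [:: q; r; a; b; x; y] ->
  joined [:: (a, b); (x, y); (q, a); (q, b); (q, x); (q, y);
             (r, q); (r, a); (r, b); (r, x); (r, y)] ->
  ~~ (inside r q a b && inside r q x y).
Proof.
move=> u6 S6 adjE; apply/negP=> ins.
have ref : refuted 6 [:: [:: (2, 3); (4, 5); (0, 2); (0, 3); (0, 4); (0, 5);
                 (1, 0); (1, 2); (1, 3); (1, 4); (1, 5)]]
  [:: (true, inside_terms 1 0 2 3); (true, inside_terms 1 0 4 5)] by vm_compute.
have {ref} /(_ adjE)/negP[] := planar_refutation (v0 := a) u6 S6 _ ref.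
by case/andP: ins => *; apply/and3P; split=> //; apply/eqP.
Qed.

(* [q] and [q'] need not be visible at the same time. *)
Lemma flipped_opposite k k' q q' a b c d :
  uniq [:: q; q'; a; b; c; d] -> all (S k) [:: q; a; b; c; d] -> all (S k') [:: q'; a; b; c; d] ->
  joined (wheel_edges q a b c d) -> joined (wheel_edges q' a b c d) ->
  flipped q a b c d -> ~~ flipped q' c d a b.
Proof.
move=> u6 S5 S5' w w' fl; apply/negP=> fl'.
have ref : refuted 6 [:: wheel_edges 0 2 3 4 5; wheel_edges 1 2 3 4 5]
  [:: (true, flipped_terms 0 2 3 4 5); (true, flipped_terms 1 4 5 2 3)] by vm_compute.
apply: (negP (frames_refutation (v0 := q) u6 _ ref)) => {ref}; last first.
  by apply/and3P; split=> //; apply/eqP.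
move=> E; rewrite !inE => /orP[]/eqP->; [exists k; move: S5 w|exists k'; move: S5' w'];
by rewrite /joined /= => /and5P[-> -> -> -> /andP[-> _]] /and5P[-> -> -> -> /and5P[-> -> -> -> _]].
Qed.

Lemma joined_rot q a b c d :
  joined (wheel_edges q b c d a) = joined (wheel_edges q a b c d).
Proof. by rewrite /joined /=; do 8?[case: (adj _ _) => //=]. Qed.

Lemma inner_rot q a b c d : inner q b c d a = inner q a b c d.
Proof. by rewrite /inner; case: (o _ _ _) (o _ _ _) (o _ _ _) (o _ _ _) => [] [] [] []. Qed.

(** Otherwise [triangle_no_exit] puts [q'] into the triangle qab too, against [outer_hub]. *)
Lemma inner_no_escape k q q' e a b c d :
  uniq [:: q; q'; e; a; b; c; d] -> all (S k) [:: q; q'; e; a; b; c; d] ->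
  joined (wheel_edges q a b c d) -> joined (wheel_edges q' a b c d) ->
  adj e q -> adj e q' -> inner q a b c d -> ~~ inside e q a b.
Proof.
move=> u7 S7 w w' eq eq' inn.
have U t : valid 7 t -> uniq _ := @valid_uniq _ q _ u7 t.
have SS t : valid 7 t -> all (S k) _ := @valid_all _ q _ (S k) t S7.
have := outer_hub (U [:: 0; 1; 3; 4; 5; 6] isT) (SS [:: 0; 1; 3; 4; 5; 6] isT) w w' inn.
apply: contra; apply: triangle_no_exit (U [:: 0; 3; 4; 2; 1] isT) (SS [:: 0; 3; 4; 2; 1] isT) _.
case/and5P: w => /= ab _ _ _ /and3P[qa qb _]; case/and5P: w' => /= _ _ _ _ /and3P[qa' qb' _].
by rewrite /joined /= qa qb ab eq eq' qa' qb'.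
Qed.

(* The octahedron with antipodes [q], [q'] joined by a path through [e] is a
   subdivision of K_5 plus an edge. *)
Lemma no_octahedron_path k q q' e a b c d :
  uniq [:: q; q'; e; a; b; c; d] -> all (S k) [:: q; q'; e; a; b; c; d] ->
  joined (wheel_edges q a b c d) -> joined (wheel_edges q' a b c d) ->
  adj e q -> adj e q' -> False.
Proof.
wlog inn : q q' / inner q a b c d => [wl|] u7 S7 w w' eq eq'.
  have U t : valid 7 t -> uniq _ := @valid_uniq _ q _ u7 t.
  have SS t : valid 7 t -> all (S k) _ := @valid_all _ q _ (S k) t S7.
  have := inner_wheel (U [:: 0; 1; 3; 4; 5; 6] isT) (SS [:: 0; 1; 3; 4; 5; 6] isT) w w'.
  case/orP=> inn; first exact: (wl q q').
  apply: (wl q' q) => //; first exact: (U [:: 1; 0; 2; 3; 4; 5; 6] isT).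
  exact: (SS [:: 1; 0; 2; 3; 4; 5; 6] isT).
have U t : valid 7 t -> uniq _ := @valid_uniq _ q _ u7 t.
have SS t : valid 7 t -> all (S k) _ := @valid_all _ q _ (S k) t S7.
have := inner_wheel_spoke (U [:: 0; 2; 3; 4; 5; 6] isT) (SS [:: 0; 2; 3; 4; 5; 6] isT) w eq inn.
(* Rotating the cycle reduces the other three triangles at [q] to the triangle qab. *)
have [w1 w1'] : joined (wheel_edges q b c d a) /\ joined (wheel_edges q' b c d a).
  by rewrite (joined_rot q) (joined_rot q').
have [w2 w2'] : joined (wheel_edges q c d a b) /\ joined (wheel_edges q' c d a b).
  by rewrite (joined_rot q) (joined_rot q').
have [w3 w3'] : joined (wheel_edges q d a b c) /\ joined (wheel_edges q' d a b c).
  by rewrite (joined_rot q) (joined_rot q').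
have inn1 : inner q b c d a by rewrite inner_rot.
have inn2 : inner q c d a b by rewrite inner_rot.
have inn3 : inner q d a b c by rewrite inner_rot.
case/or4P; apply/negP.
- exact: (@inner_no_escape k q q' e a b c d u7 S7 w w' eq eq' inn).
- exact: (@inner_no_escape k q q' e b c d a (U [:: 0; 1; 2; 4; 5; 6; 3] isT)
    (SS [:: 0; 1; 2; 4; 5; 6; 3] isT) w1 w1' eq eq' inn1).
- exact: (@inner_no_escape k q q' e c d a b (U [:: 0; 1; 2; 5; 6; 3; 4] isT)
    (SS [:: 0; 1; 2; 5; 6; 3; 4] isT) w2 w2' eq eq' inn2).
exact: (@inner_no_escape k q q' e d a b c (U [:: 0; 1; 2; 6; 3; 4; 5] isT)
    (SS [:: 0; 1; 2; 6; 3; 4; 5] isT) w3 w3' eq eq' inn3).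
Qed.

(* Otherwise [r] is in both triangles qab and qxy, and its edges to their vertices force
   each triangle to contain the other. *)
Lemma flipped_or k q r a b c d x y z t :
  uniq [:: q; r; a; b; c; d; x; y; z; t] -> all (S k) [:: q; r; a; b; c; d; x; y; z; t] ->
  joined (wheel_edges q a b c d) -> joined (wheel_edges q x y z t) ->
  joined [:: (r, q); (r, a); (r, b)] -> joined [:: (r, q); (r, x); (r, y)] ->
  flipped q a b c d || flipped q x y z t.
Proof.
move=> u10 S10 w w' ra rx.
have U s : valid 10 s -> uniq _ := @valid_uniq _ q _ u10 s.
have SS s : valid 10 s -> all (S k) _ := @valid_all _ q _ (S k) s S10.
have := wheel_triangle (U [:: 0; 1; 2; 3; 4; 5] isT) (SS [:: 0; 1; 2; 3; 4; 5] isT) w ra.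
have := wheel_triangle (U [:: 0; 1; 6; 7; 8; 9] isT) (SS [:: 0; 1; 6; 7; 8; 9] isT) w' rx.
case/orP=> [->|ins]; first by rewrite orbT.
case/orP=> [->//|ins'].
have adjE : joined [:: (a, b); (x, y); (q, a); (q, b); (q, x); (q, y);
                       (r, q); (r, a); (r, b); (r, x); (r, y)].
  case/and5P: w => /= ab _ _ _ /and3P[qa qb _]; case/and5P: w' => /= xy _ _ _ /and3P[qx qy _].
  by move: ra rx; rewrite /joined /= ab xy qa qb qx qy !andbT /= => /and3P[-> -> ->] /and3P[_ -> ->].
have := triangles_sharing_hub (U [:: 0; 1; 2; 3; 6; 7] isT) (SS [:: 0; 1; 2; 3; 6; 7] isT) adjE.
by rewrite ins ins'.
Qed.
End Configurations.

(** * Orientations of perturbed points *)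

Section Geometry.
Local Open Scope R_scope.

Definition det (p q r : point) : R :=
  (fst q - fst p) * (snd r - snd p) - (snd q - snd p) * (fst r - fst p).

Definition positive (x : R) : bool := if Rlt_dec 0 x then true else false.

Lemma positiveP x : reflect (0 < x) (positive x).
Proof. by rewrite /positive; case: Rlt_dec => ?; constructor. Qed.

Lemma positive_eqP x y : x <> 0 -> y <> 0 -> reflect (0 < x * y) (positive x == positive y).
Proof. by move=> x0 y0; case: (positiveP x) => ?; case: (positiveP y) => ?; constructor; nra. Qed.

Definition ccw (V : Type) (pos : V -> point) (a b c : V) : bool :=
  positive (det (pos a) (pos b) (pos c)).

(** In both determinant identities nonzero terms add up to 0, so they cannot all have the same
    sign. *)
Lemma ccw_orientation (V : eqType) (pos : V -> point) :
  (forall a b c, uniq [:: a; b; c] -> det (pos a) (pos b) (pos c) <> 0) ->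
  orientation (ccw pos).
Proof.
rewrite /ccw => generic; split=> [a b c|a b c u3|a b c d u4|a b c d e u5].
- by congr positive; rewrite /det; ring.
- have := generic _ _ _ u3.
  have -> : det (pos b) (pos a) (pos c) = - det (pos a) (pos b) (pos c) by rewrite /det; ring.
  by case: positiveP => ?; case: positiveP => ? //; lra.
- have nz t : valid 4 t -> uniq _ := @valid_uniq _ a _ u4 t.
  move: (generic _ _ _ (nz [:: 0; 1; 2]%N isT)) (generic _ _ _ (nz [:: 0; 1; 3]%N isT))
    (generic _ _ _ (nz [:: 0; 2; 3]%N isT)) (generic _ _ _ (nz [:: 1; 2; 3]%N isT)) => /=.
  have : det (pos a) (pos b) (pos c) - det (pos a) (pos b) (pos d)
       + det (pos a) (pos c) (pos d) - det (pos b) (pos c) (pos d) = 0 by rewrite /det; ring.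
  by do 4![case: positiveP => ?] => //= *; lra.
have nz x y : valid 5 [:: 0; x; y]%N -> _ := fun v => generic _ _ _ (@valid_uniq _ a _ u5 _ v).
have : det (pos a) (pos b) (pos c) * det (pos a) (pos d) (pos e)
     - det (pos a) (pos b) (pos d) * det (pos a) (pos c) (pos e)
     + det (pos a) (pos b) (pos e) * det (pos a) (pos c) (pos d) = 0 by rewrite /det; ring.
case: (positive_eqP (nz 1 2 isT) (nz 3 4 isT))%N => /= t1;
case: (positive_eqP (nz 1 3 isT) (nz 2 4 isT))%N => /= t2;
case: (positive_eqP (nz 1 4 isT) (nz 2 3 isT))%N => /= t3 //; lra.
Qed.

(** [f] = (m, n, k) encodes the line mx + ny = k. The inequalities are strict so that they survive
    small perturbations. *)
Definition separates (f : R * R * R) (a b c d : point) : Prop :=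
  let h z := fst (fst f) * fst z + snd (fst f) * snd z - snd f in
  (0 < h a /\ 0 < h b) /\ (h c < 0 /\ h d < 0).

Definition disjoint_segments (a b c d : point) : Prop :=
  forall z, on_segment a b z -> on_segment c d z -> False.

Definition crossing_point (a b c d : point) :=
  let l := det c d a / (det c d a - det c d b) in
  ((1 - l) * fst a + l * fst b, (1 - l) * snd a + l * snd b).

(** The weak sign conditions put the parameters of [crossing_point] on both segments into [0,1]; by
    [id] both denominators are nonzero together. *)
Lemma crossing_meets a b c d :
  det a b c * det a b d <= 0 -> det c d a * det c d b <= 0 ->
  det a b c <> det a b d -> exists z, on_segment a b z /\ on_segment c d z.
Proof.
move=> A C ne.
have id : det a b c - det a b d = det c d b - det c d a by rewrite /det; ring.
have ratio (x y : R) : x * y <= 0 -> x <> y -> 0 <= x / (x - y) /\ x / (x - y) <= 1.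
  move=> xy nxy; case: (Rtotal_order x y) => [lt|[//|gt]].
    have -> : x / (x - y) = (- x) / (y - x) by field; lra.
    split; first by apply: Rle_mult_inv_pos; [nra|lra].
    by apply: (Rmult_le_reg_r (y - x)); [lra|rewrite /Rdiv Rmult_assoc Rinv_l; nra].
  split; first by apply: Rle_mult_inv_pos; [nra|lra].
  by apply: (Rmult_le_reg_r (x - y)); [lra|rewrite /Rdiv Rmult_assoc Rinv_l; nra].
have ne' : det c d a <> det c d b by lra.
have [l0 l1] := ratio _ _ C ne'; have [m0 m1] := ratio _ _ A ne.
exists (crossing_point a b c d); split; first by exists (det c d a / (det c d a - det c d b)).
exists (det a b c / (det a b c - det a b d)); split=> //; split=> //.
by rewrite /crossing_point /det in ne ne' *; congr pair; field; split=> h;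
  first [by apply: ne; lra | by apply: ne'; lra].
Qed.

Lemma convex_pos l x y : 0 <= l <= 1 -> 0 < x -> 0 < y -> 0 < (1 - l) * x + l * y.
Proof. by move=> [l0 l1] x0 y0; case: (Rle_lt_dec x y) => ?; nra. Qed.

Lemma separates_disjoint f a b c d : separates f a b c d -> disjoint_segments a b c d.
Proof.
case: f => [[m n] k]; rewrite /separates /= => -[[ha hb] [hc hd]] z [l [l0 [l1 zl]]] [u [u0 [u1 zu]]].
have := convex_pos (conj l0 l1) ha hb.
have := @convex_pos u _ _ (conj u0 u1) (Ropp_0_gt_lt_contravar _ hc) (Ropp_0_gt_lt_contravar _ hd).
have : m * fst z + n * snd z - k = (1 - l) * (m * fst a + n * snd a - k)
    + l * (m * fst b + n * snd b - k) by rewrite zl /=; ring.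
have : m * fst z + n * snd z - k = (1 - u) * (m * fst c + n * snd c - k)
    + u * (m * fst d + n * snd d - k) by rewrite zu /=; ring.
by move=> *; lra.
Qed.

Lemma disjoint_no_crossing a b c d : disjoint_segments a b c d ->
  ~ (det a b c * det a b d < 0 /\ det c d a * det c d b < 0).
Proof.
move=> disj [A C]; have [|||z [/disj]] := @crossing_meets a b c d; try lra; last exact.
by move=> e; rewrite e in A; nra.
Qed.

(** The separating line is the level line [s * det x y z = t], parallel to xy. *)
Lemma separates_det s t x y a b c d :
  0 < s * det x y a - t -> 0 < s * det x y b - t ->
  s * det x y c - t < 0 -> s * det x y d - t < 0 -> exists f, separates f a b c d.
Proof.
exists (- s * (snd y - snd x), s * (fst y - fst x),
        t + s * (fst y - fst x) * snd x - s * (snd y - snd x) * fst x).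
by rewrite /separates /det /= in H H0 H1 H2 *; lra.
Qed.

Definition dot (p q r : point) : R :=
  (fst q - fst p) * (fst r - fst p) + (snd q - snd p) * (snd r - snd p).

(** Here the level line [s * dot x y z = t] is perpendicular to xy. *)
Lemma separates_dot s t x y a b c d :
  0 < s * dot x y a - t -> 0 < s * dot x y b - t ->
  s * dot x y c - t < 0 -> s * dot x y d - t < 0 -> exists f, separates f a b c d.
Proof.
exists (s * (fst y - fst x), s * (snd y - snd x),
        t + s * (fst y - fst x) * fst x + s * (snd y - snd x) * snd x).
by rewrite /separates /dot /= in H H0 H1 H2 *; lra.
Qed.

(** With v = b - a, w = c - a and J the quarter turn, |v|^2 w = (v.w) v + det(v,w) Jv, and the last
    term vanishes. *)
Lemma collinear_dot a b c : det a b c = 0 -> 0 < dot a b b ->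
  c = (fst a + dot a b c / dot a b b * (fst b - fst a),
       snd a + dot a b c / dot a b b * (snd b - snd a)).
Proof.
case: c => c1 c2 /= cl N; congr pair; apply: (Rmult_eq_reg_l (dot a b b)); try lra.
  transitivity (dot a b b * fst a + dot a b (c1, c2) * (fst b - fst a)); last by field; lra.
  apply: Rminus_diag_uniq; transitivity (- (snd b - snd a) * det a b (c1, c2)); last by rewrite cl; ring.
  by rewrite /det /dot /=; ring.
transitivity (dot a b b * snd a + dot a b (c1, c2) * (snd b - snd a)); last by field; lra.
apply: Rminus_diag_uniq; transitivity ((fst b - fst a) * det a b (c1, c2)); last by rewrite cl; ring.
by rewrite /det /dot /=; ring.
Qed.

Lemma on_segment_collinear a b c d z u v w :
  c = (fst a + u * (fst b - fst a), snd a + u * (snd b - snd a)) ->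
  d = (fst a + v * (fst b - fst a), snd a + v * (snd b - snd a)) ->
  z = (fst a + w * (fst b - fst a), snd a + w * (snd b - snd a)) ->
  u <= w <= v -> u < v -> on_segment c d z /\ on_segment d c z.
Proof.
move=> -> -> -> [uw wv] uv.
have r x y : 0 <= x -> x <= y -> 0 < y -> 0 <= x / y /\ x / y <= 1.
  move=> x0 xy y0; split; first exact: Rle_mult_inv_pos.
  by apply: (Rmult_le_reg_r y) => //; rewrite /Rdiv Rmult_assoc Rinv_l; lra.
split; [exists ((w - u) / (v - u))|exists ((v - w) / (v - u))]; rewrite /=.
  have [l0 l1] : 0 <= (w - u) / (v - u) /\ (w - u) / (v - u) <= 1 by apply: r; lra.
  by split=> //; split=> //; congr pair; field; lra.
have [l0 l1] : 0 <= (v - w) / (v - u) /\ (v - w) / (v - u) <= 1 by apply: r; lra.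
by split=> //; split=> //; congr pair; field; lra.
Qed.

(* If all four points are collinear, project on their line; otherwise one of the two
   supporting lines, slightly shifted, separates, or the segments meet. *)
Lemma disjoint_separates a b c d : a <> b ->
  disjoint_segments a b c d -> exists f, separates f a b c d.
Proof.
move=> ab disj.
have ab0 x y : det x y x = 0 /\ det x y y = 0 by rewrite /det; split; ring.
have [aba abb] := ab0 a b; have [cdc cdd] := ab0 c d.
case: (Rlt_le_dec 0 (det a b c * det a b d)) => [AB|AB].
  have m0 : 0 < Rmin (det a b c * det a b c) (det a b c * det a b d) by apply: Rmin_pos; nra.
  (* Scaled by [det a b c], the determinant is 0 at a and b and positive at c and d; half the
     smaller positive value lies in between. *)
  apply: (@separates_det (- det a b c)
    (- Rmin (det a b c * det a b c) (det a b c * det a b d) / 2) a b);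
  have := Rmin_l (det a b c * det a b c) (det a b c * det a b d);
  have := Rmin_r (det a b c * det a b c) (det a b c * det a b d); rewrite ?aba ?abb; lra.
case: (Rlt_le_dec 0 (det c d a * det c d b)) => [CD|CD].
  have m0 : 0 < Rmin (det c d a * det c d a) (det c d a * det c d b) by apply: Rmin_pos; nra.
  apply: (@separates_det (det c d a)
    (Rmin (det c d a * det c d a) (det c d a * det c d b) / 2) c d);
  have := Rmin_l (det c d a * det c d a) (det c d a * det c d b);
  have := Rmin_r (det c d a * det c d a) (det c d a * det c d b); rewrite ?cdc ?cdd; lra.
case: (Req_dec (det a b c) (det a b d)) => [eqAB|/(crossing_meets AB CD)[z [/disj]]//].
have c0 : det a b c = 0 by rewrite -eqAB in AB; nra.
have d0 : det a b d = 0 by rewrite -eqAB.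
have N : 0 < dot a b b.
  have := Rle_0_sqr (fst b - fst a); have := Rle_0_sqr (snd b - snd a).
  case: (Req_dec (fst b - fst a) 0) => [e1|/Rlt_0_sqr]; last by rewrite /dot /Rsqr; lra.
  case: (Req_dec (snd b - snd a) 0) => [e2|/Rlt_0_sqr]; last by rewrite /dot /Rsqr; lra.
  by case: ab; case: (a) (b) e1 e2 => ? ? [? ?] /= e1 e2; congr pair; lra.
have ca := collinear_dot c0 N; have da := collinear_dot d0 N.
set u := dot a b c / dot a b b in ca; set v := dot a b d / dot a b b in da.
have aa : a = (fst a + 0 * (fst b - fst a), snd a + 0 * (snd b - snd a)).
  by case: (a) => ? ? /=; congr pair; ring.
have ba : b = (fst a + 1 * (fst b - fst a), snd a + 1 * (snd b - snd a)).
  by case: (a) (b) => ? ? [? ?] /=; congr pair; ring.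
have ends x y : on_segment x y x /\ on_segment x y y.
  split; [exists 0|exists 1]; (split; [lra|split; [lra|]]);
  by case: (x) (y) => ? ? [? ?] /=; congr pair; ring.
have [cc dd] := ends c d.
have du : dot a b c = u * dot a b b by rewrite /u; field; lra.
have dv : dot a b d = v * dot a b b by rewrite /v; field; lra.
have da0 : dot a b a = 0 by rewrite /dot; ring.
have u01 : ~ (0 <= u <= 1).
  by move=> u01; have [|h _] := on_segment_collinear aa ba ca u01; [lra|exact: disj h cc].
have v01 : ~ (0 <= v <= 1).
  by move=> v01; have [|h _] := on_segment_collinear aa ba da v01; [lra|exact: disj h dd].
have [ea _] := ends a b.
(* On the line, a is at 0, b at 1, and c and d at [u] and [v] outside [0,1]. On a common side, cut
   halfway to the nearer one; on opposite sides, cd contains a. *)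
case: (Rlt_le_dec u 0) => u0; case: (Rlt_le_dec v 0) => v0.
- have := Rmax_l u v; have := Rmax_r u v; have : Rmax u v < 0 by apply: Rmax_lub_lt.
  by move=> ? ? ?; apply: (@separates_dot 1 (Rmax u v * dot a b b / 2) a b);
    rewrite ?du ?dv ?da0; nra.
- by have [||h _] := on_segment_collinear ca da aa; [lra|lra|case: (disj a)].
- by have [||_ h] := on_segment_collinear da ca aa; [lra|lra|case: (disj a)].
have := Rmin_l u v; have := Rmin_r u v; have : 1 < Rmin u v by apply: Rmin_glb_lt; lra.
by move=> ? ? ?; apply: (@separates_dot (- 1) (- (1 + Rmin u v) * dot a b b / 2) a b);
    rewrite ?du ?dv ?da0; nra.
Qed.

(** * Conditions valid for all small perturbations *)

Definition near0 (P : R -> Prop) := exists e, 0 < e /\ forall x, 0 < x < e -> P x.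

Lemma near0_and P Q : near0 P -> near0 Q -> near0 (fun x => P x /\ Q x).
Proof.
move=> [e [e0 Pe]] [f [f0 Qf]]; exists (Rmin e f); split; first exact: Rmin_pos.
by move=> x [x0 /Rmin_Rgt_l[xe xf]]; split; [apply: Pe|apply: Qf].
Qed.

Lemma near0_forall (T : finType) (P : T -> R -> Prop) :
  (forall i, near0 (P i)) -> near0 (fun x => forall i, P i x).
Proof.
move=> nP.
have [e [e0 Pe]] : near0 (fun x => forall i, i \in enum T -> P i x).
  elim: (enum T) => [|i s IHs]; first by exists 1; split=> //; lra.
  have [e [e0 Pe]] := near0_and (nP i) IHs; exists e; split=> // x /Pe[Pi Ps] j.
  by rewrite inE => /predU1P[->//|/Ps].
by exists e; split=> // x /Pe Px i; apply: Px; rewrite mem_enum.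
Qed.

Lemma near0_pos c0 c1 c2 : 0 < c0 -> near0 (fun x => 0 < c0 + c1 * x + c2 * (x * x)).
Proof.
move=> c0p; have h1 := Rabs_pos c1; have h2 := Rabs_pos c2.
(* For x < 1 the two other terms are at most (|c1| + |c2|) x in absolute value. *)
exists (Rmin 1 (c0 / (Rabs c1 + Rabs c2 + 1))); split.
  by apply: Rmin_pos; [lra|apply: Rdiv_lt_0_compat; lra].
move=> x [x0 /Rmin_Rgt_l[x1 xc]].
have {}xc : x * (Rabs c1 + Rabs c2 + 1) < c0.
  have -> : c0 = c0 / (Rabs c1 + Rabs c2 + 1) * (Rabs c1 + Rabs c2 + 1) by field; lra.
  by apply: Rmult_lt_compat_r; lra.
have := Rle_abs (- c1); have := Rle_abs (- c2); rewrite !Rabs_Ropp => a2 a1.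
have : - Rabs c1 * x <= c1 * x by apply: Rmult_le_compat_r; lra.
have : - Rabs c2 * (x * x) <= c2 * (x * x) by apply: Rmult_le_compat_r; nra.
have : Rabs c2 * (x * x) <= Rabs c2 * x by apply: Rmult_le_compat_l; nra.
by move=> *; lra.
Qed.

(** The lowest nonzero coefficient dominates near 0, and there is one because [c2] is nonzero. *)
Lemma near0_nonzero c0 c1 c2 : c2 <> 0 -> near0 (fun x => c0 + c1 * x + c2 * (x * x) <> 0).
Proof.
have nz a0 a1 a2 : a0 <> 0 -> near0 (fun x => a0 + a1 * x + a2 * (x * x) <> 0).
  move=> a0nz; case: (Rtotal_order a0 0) => [lt|[//|gt]].
    have [|e [e0 He]] := @near0_pos (- a0) (- a1) (- a2); first lra.
    by exists e; split=> // x /He; lra.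
  by have [e [e0 He]] := near0_pos a1 a2 gt; exists e; split=> // x /He; lra.
move=> c2nz; case: (Req_dec c0 0) => [->|/nz]; last exact.
case: (Req_dec c1 0) => [->|c1nz].
  exists 1; split=> [|x [x0 _] h]; first lra.
  apply: c2nz.
  by have xx : 0 < x * x by [nra]; apply: (Rmult_eq_reg_r (x * x)); lra.
have [e [e0 He]] := nz c1 c2 0 c1nz; exists e; split=> // x x0e h; apply: (He x x0e).
by apply: (Rmult_eq_reg_l x); lra.
Qed.

(* Moving along a moment curve makes the leading coefficient of each determinant a
   Vandermonde determinant. *)
Definition perturb (V : finType) (pos : V -> point) (x : R) (v : V) : point :=
  (fst (pos v) + x * INR (enum_rank v), snd (pos v) + x * (INR (enum_rank v) * INR (enum_rank v))).

Lemma perturb_generic (V : finType) (pos : V -> point) a b c : uniq [:: a; b; c] ->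
  near0 (fun x => det (perturb pos x a) (perturb pos x b) (perturb pos x c) <> 0).
Proof.
have rank_neq u v : u != v -> INR (enum_rank u) <> INR (enum_rank v).
  by move=> uv /INR_eq/ord_inj/enum_rank_inj uv'; rewrite uv' eqxx in uv.
rewrite /= !inE negb_or -andbA => /and4P[/rank_neq ab /rank_neq ac /rank_neq bc _].
rewrite /det /perturb /=; move: (INR (enum_rank a)) (INR (enum_rank b)) (INR (enum_rank c)) ab ac bc.
case: (pos a) (pos b) (pos c) => a1 a2 [b1 b2] [c1 c2] r s t rs rt st /=.
have nz : (s - r) * (t - r) * (t - s) <> 0 by do 2?[apply: Rmult_integral_contrapositive_currified]; lra.
have [e [e0 He]] := near0_nonzero (det (a1, a2) (b1, b2) (c1, c2))
  ((b1 - a1) * (t * t - r * r) + (s - r) * (c2 - a2) - (b2 - a2) * (t - r) - (s * s - r * r) * (c1 - a1)) nz.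
by exists e; split=> // x /He h eq0; apply: h; rewrite -[RHS]eq0 /det /=; ring.
Qed.

Lemma perturb_separates (V : finType) (pos : V -> point) f a b c d :
  separates f (pos a) (pos b) (pos c) (pos d) ->
  near0 (fun x => separates f (perturb pos x a) (perturb pos x b) (perturb pos x c) (perturb pos x d)).
Proof.
case: f => [[m n] k]; rewrite /separates /= => -[[ha hb] [hc hd]].
have near_pos s v : 0 < s * (m * fst (pos v) + n * snd (pos v) - k) ->
    near0 (fun x => 0 < s * (m * fst (perturb pos x v) + n * snd (perturb pos x v) - k)).
  move=> h; have [e [e0 He]] :=
    near0_pos (s * (m * INR (enum_rank v) + n * (INR (enum_rank v) * INR (enum_rank v)))) 0 h.
  by exists e; split=> // x /He /=; lra.
have [||||e [e0 He]] := near0_and (near0_and (@near_pos 1 a _) (@near_pos 1 b _))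
  (near0_and (@near_pos (-1) c _) (@near_pos (-1) d _)); try lra.
by exists e; split=> // x /He /= [[? ?] [? ?]]; lra.
Qed.

(** There are finitely many triples and quadruples, so one perturbation makes all triples generic
    and keeps all separated pairs of segments separated. *)
Lemma exists_orientation (V : finType) (pos : V -> point) :
  exists2 o : V -> V -> V -> bool, orientation o &
    forall a b c d, uniq [:: a; b; c; d] -> pos a <> pos b ->
      disjoint_segments (pos a) (pos b) (pos c) (pos d) -> ~~ crossing o a b c d.
Proof.
have gen : near0 (fun x => forall v : V * V * V, uniq [:: v.1.1; v.1.2; v.2] ->
    det (perturb pos x v.1.1) (perturb pos x v.1.2) (perturb pos x v.2) <> 0).
  apply: near0_forall => v; case: (boolP (uniq _)) => [/(perturb_generic pos) [e [e0 He]]|_].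
    by exists e; split=> // x /He.
  by exists 1; split; [lra|].
have sep : near0 (fun x => forall v : V * V * V * V,
    pos v.1.1.1 <> pos v.1.1.2 ->
    disjoint_segments (pos v.1.1.1) (pos v.1.1.2) (pos v.1.2) (pos v.2) ->
    exists f, separates f (perturb pos x v.1.1.1) (perturb pos x v.1.1.2)
                          (perturb pos x v.1.2) (perturb pos x v.2)).
  apply: near0_forall => v.
  case: (classic (pos v.1.1.1 <> pos v.1.1.2 /\
     disjoint_segments (pos v.1.1.1) (pos v.1.1.2) (pos v.1.2) (pos v.2))) => [[ab disj]|no].
    have [f /perturb_separates[e [e0 He]]] := disjoint_separates ab disj.
    by exists e; split=> // x /He; exists f.
  by exists 1; split=> [|x _ ab disj]; [lra|case: no].
have [e [e0 He]] := near0_and gen sep.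
have [|g s] := He (e / 2); first lra.
exists (ccw (perturb pos (e / 2))).
  by apply: ccw_orientation => a b c u3; apply: (g (a, b, c)).
move=> a b c d u4 ab disj; have [f /separates_disjoint/disjoint_no_crossing no] := s (a, b, c, d) ab disj.
have nz t : valid 4 t -> uniq _ := @valid_uniq _ a _ u4 t.
have u1 := g (a, b, c) (nz [:: 0; 1; 2]%N isT); have u2 := g (a, b, d) (nz [:: 0; 1; 3]%N isT).
have u3 := g (c, d, a) (nz [:: 2; 3; 0]%N isT); have u4' := g (c, d, b) (nz [:: 2; 3; 1]%N isT).
apply/negP=> /andP[/(positive_eqP u1 u2) /= n1 /(positive_eqP u3 u4') /= n2]; apply: no.
have m1 := Rmult_integral_contrapositive_currified _ _ u1 u2.
have m2 := Rmult_integral_contrapositive_currified _ _ u3 u4'.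
by rewrite /= in m1 m2 *; lra.
Qed.
End Geometry.

(** * Visibility intervals *)

Definition code := ('I_4 + 'I_4 + 'I_4 + 'I_4 * 'I_2 + 'I_4 * 'I_2)%type.

Definition vtx_code (v : vtx) : code :=
  match v with
  | va i => inl (inl (inl (inl i)))
  | vb i => inl (inl (inl (inr i)))
  | vc i => inl (inl (inr i))
  | vq i j => inl (inr (i, j))
  | vr i j => inr (i, j)
  end.

Definition code_vtx (c : code) : vtx :=
  match c with
  | inl (inl (inl (inl i))) => va i
  | inl (inl (inl (inr i))) => vb i
  | inl (inl (inr i)) => vc i
  | inl (inr (i, j)) => vq i j
  | inr (i, j) => vr i j
  end.

Lemma vtx_codeK : cancel vtx_code code_vtx. Proof. by case. Qed.

HB.instance Definition _ := Finite.copy vtx (can_type vtx_codeK).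

Definition adj0 (u v : vtx) : bool :=
  match u, v with
  | va i, va k => k == nxt i
  | vb i, vb k => k == nxt i
  | vc i, vc k => k == nxt i
  | vq _ _, va _ => true
  | vq _ _, vb _ => true
  | vq _ _, vc _ => true
  | vr i j, vq i' j' => (i' == i) && (j' == j)
  | vr i _, va k => (k == i) || (k == nxt i)
  | vr i _, vb k => (k == i) || (k == nxt i)
  | vr i _, vc k => (k == i) || (k == nxt i)
  | _, _ => false
  end.

Definition adjb (u v : vtx) : bool := adj0 u v || adj0 v u.

Lemma adjb_sym u v : adjb u v = adjb v u.
Proof. exact: orbC. Qed.

Lemma adjbP u v : adjb u v -> G_adj u v.
Proof.
have adj0P x y : adj0 x y -> edge0 x y.
  by case: x y => [i|i|i|i j|i j] [k|k|k|k l|k l] //=;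
    [move/eqP|move/eqP|move/eqP|case/orP=> /eqP|case/orP=> /eqP|case/orP=> /eqP|
     case/andP=> /eqP ? /eqP]; auto.
by case/orP=> /adj0P; [left|right].
Qed.

Lemma nxtE i :
  ((nxt (nxt (nxt (nxt i))) = i) * ((i == nxt i) = false) * ((i == nxt (nxt i)) = false)
   * ((i == nxt (nxt (nxt i))) = false) * ((nxt i == nxt (nxt i)) = false)
   * ((nxt i == nxt (nxt (nxt i))) = false) * ((nxt (nxt i) == nxt (nxt (nxt i))) = false))%type.
Proof. by do !split; case: i => -[|[|[|[|i]]]] ? //; apply: val_inj. Qed.

(** A common index for the cycles a, b, c allows arguments about any two of them. *)
Definition cyc (c : 'I_3) (i : 'I_4) : vtx :=
  if val c is c'.+1 then if c' is 0 then vb i else vc i else va i.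

Lemma cyc_eq c c' i i' : (cyc c i == cyc c' i') = (c == c') && (i == i').
Proof. by case: c c' => -[|[|[|?]]] ? [[|[|[|?]]] ?]. Qed.

Lemma vtxE :
  (forall c c' i i', (cyc c i == cyc c' i') = (c == c') && (i == i')) *
  (forall i i' j j', (vq i j == vq i' j') = (i == i') && (j == j')) *
  (forall c i j k, (vq i j == cyc c k) = false) * (forall c i j k, (vr i j == cyc c k) = false) *
  (forall c i j k, (cyc c k == vq i j) = false) * (forall c i j k, (cyc c k == vr i j) = false) *
  (forall i i' j j', (vq i j == vr i' j') = false) * (forall i i' j j', (vr i j == vq i' j') = false).
Proof. by do !split=> //; [exact: cyc_eq|..]; case=> -[|[|[|?]]]. Qed.

Lemma adjb_cyc c i : adjb (cyc c i) (cyc c (nxt i)).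
Proof. by case: c => -[|[|[|?]]] ? //; rewrite /cyc /adjb /= eqxx. Qed.

Lemma adjb_hub i j c k : adjb (vq i j) (cyc c k).
Proof. by case: c => -[|[|[|?]]]. Qed.

Lemma adjb_r i j c : [/\ adjb (vr i j) (vq i j), adjb (vr i j) (cyc c i) & adjb (vr i j) (cyc c (nxt i))].
Proof. by case: c => -[|[|[|?]]] ? //; rewrite /cyc /adjb /= !eqxx orbT. Qed.

Lemma wheel_joined i j c k :
  joined adjb (wheel_edges (vq i j) (cyc c k) (cyc c (nxt k)) (cyc c (nxt (nxt k)))
                           (cyc c (nxt (nxt (nxt k))))).
Proof. by have := adjb_cyc c (nxt (nxt (nxt k))); rewrite /joined /= nxtE !adjb_hub !adjb_cyc => ->. Qed.

Section Visibility.
Variables (s e : vtx -> nat).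

Definition visible (t : nat) : pred vtx := fun v => s v <= t <= e v.
Definition meet (u v : vtx) := (s u <= e v) && (s v <= e u).

(** The latest start belongs to every interval. *)
Lemma helly v0 vs : (forall u v, u \in v0 :: vs -> v \in v0 :: vs -> meet u v) ->
  exists t, all (visible t) (v0 :: vs).
Proof.
move=> meets; case: (@arg_maxnP _ v0 [in v0 :: vs] s) => [|u uL umax]; first exact: mem_head.
exists (s u); apply/allP=> v vL; have /= sv := umax v vL.
by have /andP[_] := meets _ _ vL uL; rewrite /visible sv.
Qed.
End Visibility.

(** * Order of the hubs in time, and the final contradiction *)

Section Contradiction.
Variables (s e : vtx -> nat) (o : vtx -> vtx -> vtx -> bool).
Hypotheses (se : forall v, s v <= e v) (o_or : orientation o).
Hypothesis adj_meet : forall u v, adjb u v -> meet s e u v.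
Hypothesis planar : forall t a b c d, all (visible s e t) [:: a; b; c; d] ->
  uniq [:: a; b; c; d] -> adjb a b -> adjb c d -> ~~ crossing o a b c d.

Local Notation meet := (meet s e).
Local Notation visible := (visible s e).

Lemma meet_sym u v : meet u v = meet v u.
Proof. exact: andbC. Qed.

Lemma meet_refl v : meet v v.
Proof. by rewrite /meet se. Qed.

Lemma separated_hubs i j i' j' : ~~ meet (vq i j) (vq i' j') ->
  forall c k c' k', meet (cyc c k) (cyc c' k').
Proof.
have mq c k a b : meet (vq a b) (cyc c k) := adj_meet (adjb_hub a b c k).
move=> nm c k c' k'; move: (mq c k i j) (mq c' k' i j) (mq c k i' j') (mq c' k' i' j') nm.
have := se (cyc c k); have := se (cyc c' k'); rewrite /meet; lia.
Qed.

(** Otherwise the four intervals would represent an induced C_4. *)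
Lemma cycle_chord c i :
  meet (cyc c i) (cyc c (nxt (nxt i))) || meet (cyc c (nxt i)) (cyc c (nxt (nxt (nxt i)))).
Proof.
have m1 := adj_meet (adjb_cyc c i); have m2 := adj_meet (adjb_cyc c (nxt i)).
have m3 := adj_meet (adjb_cyc c (nxt (nxt i))); have m4 := adj_meet (adjb_cyc c (nxt (nxt (nxt i)))).
move: m1 m2 m3 m4; rewrite nxtE /meet; lia.
Qed.

Lemma hub_separation : exists i j i' j', ~~ meet (vq i j) (vq i' j').
Proof.
apply: NNPP => all_meet.
have mq i j i' j' : meet (vq i j) (vq i' j').
  by apply: contraT => nm; case: all_meet; exists i, j, i', j'.
have [i chord] : exists i, meet (cyc ord0 i) (cyc ord0 (nxt (nxt i))).
  by have /orP[m|m] := cycle_chord ord0 ord0; [exists ord0|exists (nxt ord0)].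
have m1 := adj_meet (adjb_cyc ord0 i); have m2 := adj_meet (adjb_cyc ord0 (nxt i)).
have mh k a b : meet (cyc ord0 k) (vq a b) by rewrite meet_sym; apply: adj_meet (adjb_hub a b _ k).
(* The sides of the K_{3,3} are three consecutive cycle vertices and any three hubs. *)
pose L := [:: cyc ord0 i; cyc ord0 (nxt i); cyc ord0 (nxt (nxt i));
              vq ord0 ord0; vq ord0 ord_max; vq ord_max ord0].
have [t tL] : exists t, all (visible t) L.
  apply: helly => u v; rewrite -/L !inE.
  by do 5?[case/orP]; move=> /eqP->; do 5?[case/orP]; move=> /eqP->;
    rewrite ?meet_refl ?mq ?mh ?chord ?m1 ?m2 // meet_sym ?mh ?chord ?m1 ?m2.
have u6 : uniq L by rewrite /L /= !inE !vtxE !nxtE /=.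
have := no_K33 o_or planar u6 tL.
by rewrite /joined /=.
Qed.

Lemma cyc_meet c k c' k' : meet (cyc c k) (cyc c' k').
Proof. by have [i [j [i' [j' /separated_hubs]]]] := hub_separation; apply. Qed.

Lemma hubs_apart i j i' j' : (i, j) != (i', j') -> ~~ meet (vq i j) (vq i' j').
Proof.
move=> ne; apply/negP=> m.
have mh a b c k : meet (vq a b) (cyc c k) := adj_meet (adjb_hub a b c k).
(* The a-cycle is the equator of the octahedron, and a vertex of the c-cycle links the two hubs. *)
pose L := [:: vq i j; vq i' j'; cyc ord_max ord0; cyc ord0 ord0; cyc ord0 (nxt ord0);
              cyc ord0 (nxt (nxt ord0)); cyc ord0 (nxt (nxt (nxt ord0)))].
have [t tL] : exists t, all (visible t) L.
  apply: helly => u v; rewrite -/L !inE.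
  by do 6?[case/orP]; move=> /eqP->; do 6?[case/orP]; move=> /eqP->;
    rewrite ?meet_refl ?m ?mh ?cyc_meet // meet_sym ?mh ?m.
have u7 : uniq L by rewrite /L /= !inE !vtxE -xpair_eqE (negbTE ne).
have ah k c a b : adjb (cyc c k) (vq a b) by rewrite adjb_sym adjb_hub.
exact: (no_octahedron_path o_or planar u7 tL (wheel_joined _ _ _ _) (wheel_joined _ _ _ _)
  (ah _ _ _ _) (ah _ _ _ _)).
Qed.

(** As hubs are pairwise disjoint in time, this says that the hub is neither the first nor the
    last. *)
Definition middle i j := exists i1 j1 i2 j2, e (vq i1 j1) < s (vq i j) /\ e (vq i j) < s (vq i2 j2).

Lemma middle_of_three i j i' j' i'' j'' :
  (i, j) != (i', j') -> (i, j) != (i'', j'') -> (i', j') != (i'', j'') ->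
  [\/ middle i j, middle i' j' | middle i'' j''].
Proof.
move=> /hubs_apart + /hubs_apart + /hubs_apart; rewrite /meet !negb_and -!ltnNge.
have := (se (vq i j), se (vq i' j'), se (vq i'' j'')) => -[[h1 h2] h3].
by case/orP=> a1 /orP[] a2 /orP[] a3; first
  [ by apply: Or31; exists i', j', i'', j''; split; lia
  | by apply: Or31; exists i'', j'', i', j'; split; lia
  | by apply: Or32; exists i, j, i'', j''; split; lia
  | by apply: Or32; exists i'', j'', i, j; split; lia
  | by apply: Or33; exists i, j, i', j'; split; lia
  | by apply: Or33; exists i', j', i, j; split; lia ].
Qed.

(** Otherwise each of {i, i+2} and {i+1, i+3} contains an index without middle hubs; among three
    hubs with these two indices one would still be middle. *)
Lemma middle_opposite : exists i j j', middle i j /\ middle (nxt (nxt i)) j'.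
Proof.
apply: NNPP => none.
have bad i : exists2 k, (k == i) || (k == nxt (nxt i)) & forall j, ~ middle k j.
  apply: NNPP => no; apply: no; case: (classic (forall j, ~ middle i j)) => [m|].
    by exists i; rewrite ?eqxx.
  case/not_all_ex_not=> j /NNPP m; exists (nxt (nxt i)); rewrite ?eqxx ?orbT // => j' m'.
  by apply: none; exists i, j, j'.
have [k k02 nk] := bad ord0; have [l l13 nl] := bad (nxt ord0).
have kl : k != l by case/orP: k02 => /eqP->; case/orP: l13 => /eqP->.
have [||| | |] := @middle_of_three k ord0 k ord_max l ord0; try exact: nk; try exact: nl;
  by rewrite xpair_eqE ?(negbTE kl) // andbF.
Qed.

(** Every cycle vertex meets an earlier and a later hub, hence stays visible during the whole
    interval of the middle one. *)
Lemma middle_frame i j : middle i j -> exists t, [/\ visible t (vq i j), visible t (vr i j)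
  & forall c k, visible t (cyc c k)].
Proof.
move=> [i1 [j1 [i2 [j2 [lt1 lt2]]]]].
have [rq _ _] := adjb_r i j ord0.
exists (maxn (s (vq i j)) (s (vr i j))).
have := adj_meet rq; rewrite /visible /meet => /andP[m1 m2]; have := se (vq i j); have := se (vr i j).
split=> [||c k]; try lia.
have := adj_meet (adjb_hub i1 j1 c k); have := adj_meet (adjb_hub i2 j2 c k); rewrite /meet; lia.
Qed.

Definition flips c i j :=
  flipped o (vq i j) (cyc c i) (cyc c (nxt i)) (cyc c (nxt (nxt i))) (cyc c (nxt (nxt (nxt i)))).

Lemma flips_or c c' i j : c != c' -> middle i j -> flips c i j || flips c' i j.
Proof.
move=> cc' /middle_frame[t [tq tr tc]]; have [rq rc rc1] := adjb_r i j c.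
have [_ rc' rc1'] := adjb_r i j c'.
apply: (flipped_or o_or planar (r := vr i j) (k := t) _ _ (wheel_joined _ _ _ _) (wheel_joined _ _ _ _)).
- by rewrite /= !inE !vtxE !nxtE (negbTE cc') !andbF.
- by rewrite /= tq tr !tc.
- by rewrite /joined /= rq rc rc1.
by rewrite /joined /= rq rc' rc1'.
Qed.

Lemma not_flips_opposite c i j j' : middle i j -> middle (nxt (nxt i)) j' ->
  flips c i j -> ~~ flips c (nxt (nxt i)) j'.
Proof.
move=> /middle_frame[t [tq _ tc]] /middle_frame[t' [tq' _ tc']].
have w := wheel_joined (nxt (nxt i)) j' c i.
rewrite /flips !nxtE; apply: (flipped_opposite o_or planar (k := t) (k' := t')) => //.
- by rewrite /= !inE !vtxE !nxtE !andbF.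
- by rewrite /= tq !tc.
- by rewrite /= tq' !tc'.
exact: wheel_joined.
Qed.

Lemma no_visibility : False.
Proof.
have [i [j [j' [m m']]]] := middle_opposite.
pose c0 : 'I_3 := @Ordinal 3 0 isT; pose c1 : 'I_3 := @Ordinal 3 1 isT.
pose c2 : 'I_3 := @Ordinal 3 2 isT.
have [o01 o02 o12] : [/\ c0 != c1, c0 != c2 & c1 != c2] by [].
have no c : ~~ (flips c i j && flips c (nxt (nxt i)) j').
  by apply/negP=> /andP[f]; apply/negP; apply: not_flips_opposite m m' f.
(* At most one cycle fails to flip for i and at most one for i+2, so one of the three flips for
   both. *)
move: (flips_or o01 m) (flips_or o02 m) (flips_or o12 m) (no c0) (no c1) (no c2).
move: (flips_or o01 m') (flips_or o02 m') (flips_or o12 m').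
by do 6!case: (flips _ _ _).
Qed.
End Contradiction.

Theorem theorem2 : ~ has_planar_geometric_storyplan G_adj.
Proof.
move=> [l [s [e [pos [int [edges frames]]]]]].
have [o o_or o_planar] := exists_orientation pos.
apply: (@no_visibility s e o) => //.
- by move=> v; have [_ [/leP]] := int v.
- move=> u v /adjbP/edges[t [/andP[su ue] /andP[sv ve]]].
  by rewrite /meet (leq_trans su ve) (leq_trans sv ue).
move=> t a b c d; rewrite /= => /and5P[ta tb tc td _] u4 ab cd.
have t_range : 1 <= t <= l.
  by have [/leP s1 [_ /leP el]] := int a; have /andP[sa ea] := ta; lia.
have [pos_inj [_ disj]] := frames t t_range.
have := u4; rewrite /= !inE !negb_or -!andbA => /and5P[nab nac nad nbc /andP[nbd _]].
apply: o_planar u4 _ _; first by apply: pos_inj ta tb _; apply/eqP.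
move=> z zab zcd.
(* A common point would be the position of a common end, but the four ends are distinct. *)
have [|w [w_ab [w_cd _]]] := disj a b c d z ta tb tc td
  (adjbP ab) (adjbP cd) _ zab zcd.
  by case=> -[/eqP eq _]; move: eq; apply/negP.
by case: w_ab w_cd => -> [] /eqP; apply/negP.
Qed.
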